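(* Let $A\in\mathbb{R}^{n\times n}$, $B\in\mathbb{R}^{n\times m}$ with $(A,B)$ stabilizable, let $\Sigma\in\mathbb{R}^{n\times n}$ be diagonal and positive semidefinite, and let $\mathscr{X}\subseteq\mathbb{R}^{n+n\cdot n}$, $\mathscr{U}\subseteq\mathbb{R}^{m+n\cdot n}$ be closed sets. Let $S_1,S_2\subseteq\mathbb{R}^{n+n\cdot n}$ be polytopes that are either connected (adjacent) or intersecting, let $T>0$, let $N\ge 1$ be an integer, $\delta\mathcal{T}=T/N$, $\mathcal{T}_i=i\,\delta\mathcal{T}$ for $i=0,\dots,N$, $\mathbf{T}=\{\mathcal{T}_0,\dots,\mathcal{T}_N\}$, and let $R\in\mathbb{R}^{m\times m}$ be positive semidefinite. Let $K\in\mathbb{R}^{m\times n}$ be a constant gain, $D\in\mathbb{R}^{n\cdot n}$ and $\mathcal{M}\in\mathbb{R}$ be such that (i) $A+BK$ is stable, (ii) $\|\mathcal{A}(K)\mathcal{X}+\mathcal{B}\mathcal{U}\|\le\mathcal{M}$ for all $(\mathcal{X},\mathcal{U})\in\mathscr{X}\times\mathscr{U}$, where $\mathscr{X}$ contains the state trajectory $\mathcal{X}(t)$ for all $t\in[0,T]$, and (iii) the covariance component of the trajectory satisfies $0\preceq vec(P(t))\preceq D$ (componentwise). Let $\mathcal{X}(0)\in S_1$ be a given initial state. Suppose $k[\mathcal{T}_0],\dots,k[\mathcal{T}_N]\in\mathbb{R}^m$ is a solution of $$\min_{k}\ \sum_{i=0}^{N}k[\mathcal{T}_i]^TRk[\mathcal{T}_i]$$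 subject to $$\dot{\mathcal{X}}(t)=\mathcal{A}(K)\mathcal{X}(t)+\mathcal{B}\mathcal{U}(t)\quad\forall t\in[0,T],$$ $$\mathcal{U}(\mathcal{T})\in\mathscr{U}\quad\forall\mathcal{T}\in\mathbf{T},$$ $$dist_{S_1}(\mathcal{X}(\mathcal{T}))\le-\mathcal{M}\cdot\delta\mathcal{T}\quad\forall\mathcal{T}\in\mathbf{T},$$ $$\mathcal{X}(T)\in S_2,$$ where $k(t)$ is the zero-order hold of $k[\cdot]$ and $\mathcal{U}(t)=\begin{bmatrix}k(t)\\ vec(\Sigma)\end{bmatrix}$. Then $K$ and the zero-order-hold control $k(t)$ achieve a timed transition from $\mathcal{X}(0)\in S_1$ into $S_2$ at time $T$; that is, the resulting trajectory satisfies $$\dot{\mathcal{X}}(t)=\mathcal{A}(K)\mathcal{X}(t)+\mathcal{B}\mathcal{U}(t)\ \ \forall t\in[0,T],\qquad \mathcal{U}(t)\in\mathscr{U}\ \ \forall t\in[0,T],\qquad \mathcal{X}(t)\in S_1\ \ \forall t\in[0,T),\qquad \mathcal{X}(T)\in S_2.$$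
   Context: Setting. The underlying stochastic system is $dX(t)=(AX(t)+Bu(X(t)))dt+dW(t)$ in $\mathbb{R}^n$ with zero-mean, possibly non-Gaussian noise of covariance $\Sigma$ and feedback law $u(X(t))=K(t)X(t)+k(t)$. The mean $\overline{X}(t)=\mathbb{E}[X(t)]$ and covariance $P(t)=Cov(X(t),X(t))$ evolve by $\dot{\overline{X}}=(A+BK)\overline{X}+Bk$ and $\dot P=(A+BK)P+P(A+BK)^T+\Sigma$. Augmented dynamics. With $vec(\cdot)$ stacking the columns of a matrix, $\otimes$ the Kronecker product and $I_n$ the identity, put $$\mathcal{X}(t)=\begin{bmatrix}\overline{X}(t)\\ vec(P(t))\end{bmatrix}\in\mathbb{R}^{n+n\cdot n},\quad \mathcal{U}(t)=\begin{bmatrix}k(t)\\ vec(\Sigma)\end{bmatrix},$$ $$\mathcal{A}(K)=\begin{bmatrix}A+BK&0\\0&I_n\otimes(A+BK)+(A+BK)\otimes I_n\end{bmatrix},\quad \mathcal{B}=\begin{bmatrix}B&0\\0&I_{n\cdot n}\end{bmatrix},$$ so that $\dot{\mathcal{X}}(t)=\mathcal{A}(K)\mathcal{X}(t)+\mathcal{B}\mathcal{U}(t)$. The set $\mathscr{U}$ encodes componentwise bounds $k_{min}\preceq k\preceq k_{max}$ (with $vec(\Sigma)$ fixed); the set $\mathscr{X}$ encodes componentwise bounds $\overline{X}_{min}\preceq\overline{X}\preceq\overline{X}_{max}$ and $0\preceq vec(P)\preceq D$. Signed distance. For $S\subseteq\mathbb{R}^{n+n\cdot n}$ with complement $S^C$,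 $dist_S(\mathcal{X})=\min_{\mathcal{Y}\in S}\|\mathcal{X}-\mathcal{Y}\|-\inf_{\mathcal{Z}\in S^C}\|\mathcal{X}-\mathcal{Z}\|$; it is negative the distance to the boundary if $\mathcal{X}\in S$ and the positive distance to the boundary if $\mathcal{X}\notin S$. Zero-order hold. $k(t)=k[\mathcal{T}_i]$ for $t\in[\mathcal{T}_i,\mathcal{T}_{i+1})$, $i=0,\dots,N-1$, and $k(T)=k[\mathcal{T}_N]$. *)

(* Defs.v *)
From HB Require Import structures.
From mathcomp Require Import all_boot all_order all_algebra.
From mathcomp Require Import complex mxtens.
From mathcomp Require Import all_classical all_reals all_analysis.

Set Implicit Arguments.
Unset Strict Implicit.
Unset Printing Implicit Defensive.

Import Order.TTheory GRing.Theory Num.Theory.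
Import numFieldNormedType.Exports.

Local Open Scope classical_set_scope.
Local Open Scope ring_scope.

(* The canonical norm on matrices is the sup norm; distances here are
   Euclidean.  (The topology is the same.) *)
Definition enorm (R : realType) (d : nat) (x : 'cV[R]_d) : R :=
  Num.sqrt (\sum_i x i 0 ^+ 2).

Definition cvle (R : realType) (d : nat) (x y : 'cV[R]_d) : Prop :=
  forall i, x i 0 <= y i 0.

Definition psd (R : realType) (d : nat) (M : 'M[R]_d) : Prop :=
  M^T = M /\ forall x : 'cV[R]_d, 0 <= (x^T *m M *m x) 0 0.

Definition hurwitz (R : realType) (d : nat) (M : 'M[R]_d) : Prop :=
  forall z : R[i],
    eigenvalue (map_mx (real_complex R) M) z -> complex.Re z < 0.

Definition stabilizable (R : realType) (n m : nat)
    (A : 'M[R]_n) (B : 'M[R]_(n, m)) : Prop :=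
  exists K : 'M[R]_(m, n), hurwitz (A + B *m K).

(* Column stacking: [mxtens_unindex] splits the index j * p + i as (j, i),
   which is the indexing convention of the Kronecker product [*t]. *)
Definition vec (R : realType) (p q : nat) (M : 'M[R]_(p, q)) : 'cV[R]_(q * p) :=
  \col_l M (mxtens_unindex l).2 (mxtens_unindex l).1.

Definition aug_A (R : realType) (n m : nat) (A : 'M[R]_n) (B : 'M[R]_(n, m))
    (K : 'M[R]_(m, n)) : 'M[R]_(n + n * n) :=
  block_mx (A + B *m K) 0
           0 (1%:M *t (A + B *m K) + (A + B *m K) *t 1%:M).

Definition aug_B (R : realType) (n m : nat) (B : 'M[R]_(n, m)) :
    'M[R]_(n + n * n, m + n * n) :=
  block_mx B 0 0 1%:M.

(* The covariance block of [aug_A] is the vectorised Lyapunov operator. *)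
Lemma vec_lyapunov (R : realType) (n : nat) (F P : 'M[R]_n) :
  (1%:M *t F + F *t 1%:M) *m vec P = vec (F *m P + P *m F^T).
Proof.
have pairE (G : 'I_(n * n) -> R) :
    \sum_l G l = \sum_a \sum_b G (mxtens_index (a, b)).
  rewrite pair_bigA (reindex (@mxtens_index n n)) /=; last first.
    exists (@mxtens_unindex n n) => u _;
      by rewrite (mxtens_indexK, mxtens_unindexK).
  by apply: eq_bigr => -[a b].
rewrite mulmxDl; apply/matrixP => l o; rewrite !ord1 {o}.
case: (mxtens_indexP l) => j i {l}.
rewrite [LHS]mxE [RHS]mxE mxtens_indexK [RHS]mxE; congr (_ + _).
  rewrite !mxE pairE (bigD1 j) //= [X in _ + X]big1 ?addr0 => [|a aj].
    by apply: eq_bigr => b _; rewrite !mxE !mxtens_indexK /= eqxx mul1r.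
  apply: big1 => b _.
  by rewrite !mxE !mxtens_indexK /= eq_sym (negbTE aj) !mul0r.
rewrite !mxE pairE; apply: eq_bigr => a _.
rewrite (bigD1 i) //= big1 ?addr0 => [|b bi].
  by rewrite !mxE !mxtens_indexK /= eqxx mulr1 mulrC.
by rewrite !mxE !mxtens_indexK /= eq_sym (negbTE bi) mulr0 mul0r.
Qed.

(* Extended-real valued, so that no junk value arises when [S] or its
   complement is empty.  For closed nonempty [S] the first infimum is a
   minimum. *)
Definition signed_dist (R : realType) (d : nat) (S : set 'cV[R]_d)
    (x : 'cV[R]_d) : \bar R :=
  (ereal_inf [set (enorm (x - y))%:E | y in S]
   - ereal_inf [set (enorm (x - z))%:E | z in ~` S])%E.

Definition polytope (R : realType) (d : nat) (S : set 'cV[R]_d) : Prop :=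
  bounded_set S /\
  exists (p : nat) (H : 'M[R]_(p, d)) (h : 'cV[R]_p),
    S = [set x | cvle (H *m x) h].

Definition sample_time (R : realType) (T : R) (N : nat) (i : nat) : R :=
  i%:R * (T / N%:R).

(* [k] is indexed by 0, ..., N.  For t in [0, T] the truncated quotient is the
   index of the sampling interval containing t, and it is N exactly at t = T. *)
Definition zoh (R : realType) (m : nat) (T : R) (N : nat)
    (k : 'I_N.+1 -> 'cV[R]_m) (t : R) : 'cV[R]_m :=
  k (inord (Num.truncn (t / (T / N%:R)))).

Lemma zohE (R : realType) (m : nat) (T : R) (N : nat)
    (k : 'I_N.+1 -> 'cV[R]_m) (i : 'I_N.+1) (t : R) :
  0 < T -> (0 < N)%N ->
  sample_time T N i <= t < sample_time T N i.+1 -> zoh T k t = k i.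
Proof.
move=> T0 N0; rewrite /sample_time => /andP[it ti].
have d0 : 0 < T / N%:R by rewrite divr_gt0 // ltr0n.
rewrite /zoh (@truncn_def _ _ i); first by rewrite inord_val.
by rewrite ler_pdivlMr // ltr_pdivrMr // it.
Qed.

Definition aug_input (R : realType) (n m : nat) (Sigma : 'M[R]_n) (T : R)
    (N : nat) (k : 'I_N.+1 -> 'cV[R]_m) (t : R) : 'cV[R]_(m + n * n) :=
  col_mx (zoh T k t) (vec Sigma).

(* Since the input jumps at the sampling times, the solution of the ODE is
   continuous, differentiable between sampling times, and right-differentiable
   at every time before [T]; at a sampling time a two-sided derivative need not
   exist. *)
Definition solves_aug_ode (R : realType) (n m : nat) (A : 'M[R]_n)
    (B : 'M[R]_(n, m)) (Sigma : 'M[R]_n) (K : 'M[R]_(m, n)) (T : R) (N : nat)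
    (k : 'I_N.+1 -> 'cV[R]_m) (X : R -> 'cV[R]_(n + n * n)) : Prop :=
  let rhs t := aug_A A B K *m X t + aug_B B *m aug_input Sigma T k t in
  [/\ {within `[0, T], continuous X},
      forall t : R, 0 <= t < T ->
        h^-1 *: (X (t + h) - X t) @[h --> 0^'+] --> rhs t
    & forall t : R, 0 < t < T -> (forall i : 'I_N.+1, t <> sample_time T N i) ->
        is_derive t 1 X (rhs t)].

Definition control_cost (R : realType) (m N : nat) (Q : 'M[R]_m)
    (k : 'I_N.+1 -> 'cV[R]_m) : R :=
  \sum_(i < N.+1) ((k i)^T *m Q *m k i) 0 0.

Definition feasible (R : realType) (n m : nat) (A : 'M[R]_n)
    (B : 'M[R]_(n, m)) (Sigma : 'M[R]_n) (U : set 'cV[R]_(m + n * n))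
    (S1 S2 : set 'cV[R]_(n + n * n)) (T : R) (N : nat) (K : 'M[R]_(m, n))
    (M : R) (X0 : 'cV[R]_(n + n * n)) (k : 'I_N.+1 -> 'cV[R]_m) : Prop :=
  exists X : R -> 'cV[R]_(n + n * n),
    [/\ X 0 = X0,
        solves_aug_ode A B Sigma K T k X,
        forall i : 'I_N.+1, U (aug_input Sigma T k (sample_time T N i)),
        forall i : 'I_N.+1,
          (signed_dist S1 (X (sample_time T N i)) <= (- (M * (T / N%:R)))%:E)%E
      & S2 (X T)].

Definition optimal (R : realType) (n m : nat) (A : 'M[R]_n)
    (B : 'M[R]_(n, m)) (Sigma : 'M[R]_n) (U : set 'cV[R]_(m + n * n))
    (S1 S2 : set 'cV[R]_(n + n * n)) (T : R) (N : nat) (Q : 'M[R]_m)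
    (K : 'M[R]_(m, n)) (M : R) (X0 : 'cV[R]_(n + n * n))
    (k : 'I_N.+1 -> 'cV[R]_m) : Prop :=
  feasible A B Sigma U S1 S2 T K M X0 k /\
  forall k' : 'I_N.+1 -> 'cV[R]_m,
    feasible A B Sigma U S1 S2 T K M X0 k' ->
    control_cost Q k <= control_cost Q k'.

(* Main.v *)
(* The trajectory witnessing feasibility is the given one: their difference Y
   solves a linear homogeneous equation between sampling times, and
   exp (- 2 L t) |Y t|^2 is nonincreasing when L bounds the quadratic form of
   the system matrix.  The speed of the trajectory is at most M, so within a
   sampling interval it moves by less than M (T / N) if 0 < M, whereas the
   signed-distance constraint keeps the complement of S1 at distance at least
   M (T / N) from the sampled state.  If M = 0 the trajectory does not move, and
   the sampled state lies in S1 because polytopes are closed. *)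
Require Import Defs.
From HB Require Import structures.
From mathcomp Require Import all_boot all_order all_algebra.
From mathcomp Require Import all_classical all_reals all_analysis.
From mathcomp Require Import ring lra.

Set Implicit Arguments.
Unset Strict Implicit.
Unset Printing Implicit Defensive.

Import Order.TTheory GRing.Theory Num.Theory.
Import numFieldNormedType.Exports.

Local Open Scope classical_set_scope.
Local Open Scope ring_scope.

(** * Euclidean inner product and norm *)

Definition dotv (R : realType) (d : nat) (x y : 'cV[R]_d) : R :=
  \sum_i x i 0 * y i 0.

Lemma dotvv_ge0 (R : realType) (d : nat) (x : 'cV[R]_d) : 0 <= dotv x x.
Proof. by apply: sumr_ge0 => i _; rewrite -expr2 sqr_ge0. Qed.

Lemma dotvBr (R : realType) (d : nat) (x y z : 'cV[R]_d) :
  dotv x (y - z) = dotv x y - dotv x z.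
Proof. by rewrite -sumrB; apply: eq_bigr => i _; rewrite !mxE mulrBr. Qed.

Lemma sqr_coord_le_dotvv (R : realType) (d : nat) (x : 'cV[R]_d) (i : 'I_d) :
  x i 0 ^+ 2 <= dotv x x.
Proof.
rewrite /dotv (bigD1 i) //= expr2 lerDl.
by apply: sumr_ge0 => j _; rewrite -expr2 sqr_ge0.
Qed.

Lemma dotvv_le0_eq0 (R : realType) (d : nat) (x : 'cV[R]_d) :
  dotv x x <= 0 -> x = 0.
Proof.
move=> x0; apply/colP => i; rewrite mxE; apply/eqP.
by rewrite -sqrf_eq0 eq_le sqr_ge0 (le_trans (sqr_coord_le_dotvv x i)).
Qed.

Lemma enorm_ge0 (R : realType) (d : nat) (x : 'cV[R]_d) : 0 <= enorm x.
Proof. exact: sqrtr_ge0. Qed.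

Lemma sqr_enorm (R : realType) (d : nat) (x : 'cV[R]_d) :
  enorm x ^+ 2 = dotv x x.
Proof.
rewrite sqr_sqrtr; last by apply: sumr_ge0 => i _; exact: sqr_ge0.
by apply: eq_bigr => i _; rewrite expr2.
Qed.

Lemma enorm_le0_eq0 (R : realType) (d : nat) (x : 'cV[R]_d) :
  enorm x <= 0 -> x = 0.
Proof.
move=> x0; apply: dotvv_le0_eq0; rewrite -sqr_enorm.
by rewrite (_ : enorm x = 0) ?expr0n //; apply/eqP; rewrite eq_le x0 enorm_ge0.
Qed.

Lemma enormB (R : realType) (d : nat) (x y : 'cV[R]_d) :
  enorm (x - y) = enorm (y - x).
Proof. by congr Num.sqrt; apply: eq_bigr => i _; rewrite !mxE -sqrrN opprB. Qed.

Lemma coord_le_enorm (R : realType) (d : nat) (x : 'cV[R]_d) (i : 'I_d) :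
  `|x i 0| <= enorm x.
Proof.
rewrite -(@ler_pXn2r _ 2) ?nnegrE ?enorm_ge0 // sqr_enorm.
rewrite real_normK ?num_real //.
exact: sqr_coord_le_dotvv.
Qed.

(** Cauchy-Schwarz: expanding the squares [(a * x_i - b * y_i)^2] with [a = |y|] and [b = |x|]
    leaves a common factor [2 |x| |y|], cancelled once both norms are positive. *)
Lemma dotv_le_enorm (R : realType) (d : nat) (x y : 'cV[R]_d) :
  dotv x y <= enorm x * enorm y.
Proof.
have key (a b : R) :
    2 * a * b * dotv x y <= a ^+ 2 * dotv x x + b ^+ 2 * dotv y y.
  rewrite /dotv !mulr_sumr -big_split /=; apply: ler_sum => i _.
  by rewrite -subr_ge0; have := sqr_ge0 (a * x i 0 - b * y i 0); nra.
have [/enorm_le0_eq0 ->|x0] := leP (enorm x) 0.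
  rewrite [leLHS]big1 ?mulr_ge0 ?enorm_ge0 // => i _.
  by rewrite mxE mul0r.
have [/enorm_le0_eq0 ->|y0] := leP (enorm y) 0.
  rewrite [leLHS]big1 ?mulr_ge0 ?enorm_ge0 // => i _.
  by rewrite mxE mulr0.
have := key (enorm y) (enorm x); rewrite -!sqr_enorm => h.
have xy0 : 0 < 2 * enorm y * enorm x by rewrite !mulr_gt0.
by rewrite -(ler_pM2l xy0); apply: le_trans h _; rewrite le_eqVlt;
  apply/predU1P; left; ring.
Qed.

(** Each [|x_i| |x_j|] is at most the mean of [x_i^2] and [x_j^2], hence at most [dotv x x]. A crude
    constant suffices, since it only serves as a decay rate in the energy estimate. *)
Lemma quadratic_form_le (R : realType) (d : nat) (E : 'M[R]_d) (x : 'cV[R]_d) :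
  dotv x (E *m x) <= (\sum_i \sum_j `|E i j|) * dotv x x.
Proof.
rewrite /dotv -/(dotv x x) mulr_suml; apply: ler_sum => i _.
rewrite mxE mulr_sumr mulr_suml; apply: ler_sum => j _.
apply: le_trans (ler_norm _) _.
rewrite mulrCA normrM ler_wpM2l // normrM.
have := sqr_coord_le_dotvv x i; have := sqr_coord_le_dotvv x j.
rewrite -(real_normK (num_real (x i 0))) -(real_normK (num_real (x j 0))).
by have := sqr_ge0 (`|x i 0| - `|x j 0|); nra.
Qed.

(** * Calculus of vector-valued functions *)

Lemma is_derive_coord (R : realType) (d : nat) (X : R -> 'cV[R]_d) (t : R)
    (dX : 'cV[R]_d) (i : 'I_d) :
  is_derive t 1 X dX -> is_derive t 1 (fun s => X s i 0) (dX i 0).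
Proof.
move=> [XD <-]; split; first exact: (derivable_mxP X t 1).1 XD i 0.
by rewrite derive_mx // mxE.
Qed.

Lemma is_derive_dotv (R : realType) (d : nat) (X Y : R -> 'cV[R]_d) (t : R)
    (dX dY : 'cV[R]_d) :
  is_derive t 1 X dX -> is_derive t 1 Y dY ->
  is_derive t 1 (fun s => dotv (X s) (Y s)) (dotv (X t) dY + dotv (Y t) dX).
Proof.
move=> XD YD.
have -> : (fun s => dotv (X s) (Y s)) =
    \sum_(i < d) ((fun s => X s i 0) * (fun s => Y s i 0)).
  by apply/funext => s; rewrite fct_sumE.
rewrite /dotv -big_split /=.
apply: is_derive_sum => i; apply: is_deriveM; exact: is_derive_coord.
Qed.

Lemma within_continuous_coord (R : realType) (d : nat) (D : set R)
    (X : R -> 'cV[R]_d) (i : 'I_d) :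
  {within D, continuous X} -> {within D, continuous (fun s => X s i 0)}.
Proof.
move=> XC t.
apply: (@continuous_comp _ _ _ (X : subspace D -> 'cV[R]_d) (fun M => M i 0)).
  exact: XC.
exact: coord_continuous.
Qed.

Lemma within_continuous_dotv (R : realType) (d : nat) (D : set R)
    (X Y : R -> 'cV[R]_d) :
  {within D, continuous X} -> {within D, continuous Y} ->
  {within D, continuous (fun s => dotv (X s) (Y s))}.
Proof.
move=> XC YC t; apply: cvg_big => [|i _]; first exact: add_continuous.
by apply: cvgM; exact: within_continuous_coord.
Qed.

Lemma mean_value_enorm (R : realType) (d : nat) (X dX : R -> 'cV[R]_d)
    (a b M : R) :
  a <= b -> (forall t, t \in `]a, b[ -> is_derive t 1 X (dX t)) ->
  (forall t, t \in `]a, b[ -> enorm (dX t) <= M) ->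
  {within `[a, b], continuous X} ->
  enorm (X b - X a) <= M * (b - a).
Proof.
rewrite le_eqVlt => /predU1P[-> _ _ _|ab XD dXM XC].
  by rewrite !subrr mulr0 /enorm big1 ?sqrtr0 // => i _; rewrite !mxE expr0n.
(* Scalar mean value theorem for the component of [X] along [v]. *)
pose v : 'cV[R]_d := X b - X a.
have fD t : t \in `]a, b[ ->
    is_derive t 1 (fun s => dotv v (X s)) (dotv v (dX t)).
  move=> tab; apply: is_derive_eq.
    exact: is_derive_dotv (is_derive_cst v t 1) (XD t tab).
  by rewrite [X in _ + X]big1 ?addr0 // => i _; rewrite mxE mulr0.
have fC : {within `[a, b], continuous (fun s => dotv v (X s))}.
  by apply: within_continuous_dotv XC => s; exact: cvg_cst.
have [t tab] := MVT ab fD fC.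
rewrite -dotvBr -/v -sqr_enorm => vE.
(* A factor [|v|] is cancelled below, so [v = 0] is treated apart; there [0 <= M] follows from the
   speed bound at [t]. *)
have [v0|v0] := leP (enorm v) 0.
  apply: le_trans v0 _; rewrite mulr_ge0 ?subr_ge0 ?(ltW ab) //.
  exact: le_trans (enorm_ge0 _) (dXM _ tab).
rewrite -(ler_pM2l v0) -expr2 vE mulrA ler_wpM2r ?subr_ge0 ?(ltW ab) //.
apply: le_trans (dotv_le_enorm _ _) _; rewrite ler_wpM2l ?enorm_ge0 //.
exact: dXM.
Qed.

(** * Uniqueness for homogeneous linear equations *)

Lemma is_derive_expRM (R : realType) (c s : R) :
  is_derive s 1 (fun t => expR (c * t)) (c * expR (c * s)).
Proof.
have cD : is_derive s 1 (cst c * id) c.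
  have := is_deriveM (is_derive_cst c s 1) (is_derive_id s 1).
  by rewrite /GRing.scale /= mulr1 mulr0 addr0.
rewrite [c * _]mulrC; exact: is_derive1_comp (is_derive_expR _) cD.
Qed.

(** Gronwall argument with an integrating factor. Asking for the derivative on the open interval
    only, with continuity up to the ends, accommodates input jumps at sampling times. *)
Lemma linear_ode_eq0 (R : realType) (d : nat) (E : 'M[R]_d) (Y : R -> 'cV[R]_d)
    (a b : R) :
  (forall t, t \in `]a, b[ -> is_derive t 1 Y (E *m Y t)) ->
  {within `[a, b], continuous Y} -> Y a = 0 ->
  forall t, a <= t <= b -> Y t = 0.
Proof.
move=> YD YC Ya t /andP[at_ tb].
pose L := \sum_i \sum_j `|E i j|.
pose g s := expR (- (2 * L) * s) * dotv (Y s) (Y s).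
(* The rate [2 * L] makes the bracket nonpositive by [quadratic_form_le]. *)
pose dg s := expR (- (2 * L) * s) * (2 * dotv (Y s) (E *m Y s)
  - 2 * L * dotv (Y s) (Y s)).
have gD s : s \in `]a, b[ -> is_derive s 1 g (dg s).
  move=> sab.
  have := is_deriveM (is_derive_expRM (- (2 * L)) s)
    (is_derive_dotv (YD s sab) (YD s sab)).
  move=> gD; apply: (is_derive_eq gD).
  by rewrite /dg /GRing.scale /=; ring.
have gC : {within `[a, b], continuous g}.
  move=> s; apply: cvgM; last exact: within_continuous_dotv.
  apply: continuous_subspaceT s => s.
  apply: continuous_comp; last exact: continuous_expR.
  by apply: cvgM; [exact: cvg_cst | exact: cvg_id].
have gle : g t <= g a.
  apply: (@ler0_derive1_nincr R g a b) => //.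
  - by move=> s /gD[].
  - move=> s sab; rewrite derive1E (@derive_val _ _ _ _ _ _ _ (gD s sab)).
    rewrite /dg pmulr_rle0 ?expR_gt0 // subr_le0 -mulrA ler_pM2l //.
    exact: quadratic_form_le.
apply: dotvv_le0_eq0; move: gle; rewrite /g Ya.
rewrite (_ : dotv 0 0 = 0) ?mulr0 ?pmulr_rle0 ?expR_gt0 //.
by rewrite /dotv big1 // => i _; rewrite mxE mul0r.
Qed.

(** * Polytopes and the signed distance *)

Lemma polytope_enorm_closed (R : realType) (d : nat) (S : set 'cV[R]_d)
    (x : 'cV[R]_d) :
  polytope S -> (forall e, 0 < e -> exists2 y, S y & enorm (x - y) < e) -> S x.
Proof.
move=> [_ [p [H [h ->]]]] xS /= i.
(* Row [i] of [H] is Lipschitz for the Euclidean norm with constant [c]. Since [c] may vanish, the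
   tolerance is [e / (c + 1)]. *)
pose c := \sum_j `|H i j|; have c0 : 0 <= c by apply: sumr_ge0.
apply/ler_addgt0Pr => e e0.
have c1 : 0 < c + 1 by rewrite ltr_wpDl.
have [y yS xy] := xS (e / (c + 1)) (divr_gt0 e0 c1).
have hxy : (H *m (x - y)) i 0 <= c * enorm (x - y).
  rewrite mxE mulr_suml; apply: ler_sum => j _.
  apply: le_trans (ler_norm _) _.
  by rewrite normrM ler_wpM2l // coord_le_enorm.
move: xy; rewrite ltr_pdivlMr // => xy.
rewrite mulmxBr mxE [X in _ + X]mxE in hxy.
by have := enorm_ge0 (x - y); have := yS i; nra.
Qed.

Lemma signed_dist_le (R : realType) (d : nat) (S : set 'cV[R]_d)
    (x : 'cV[R]_d) (r : R) :
  S !=set0 -> 0 <= r -> (signed_dist S x <= (- r)%:E)%E ->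
  (forall e, 0 < e -> exists2 y, S y & enorm (x - y) < e) /\
  (forall z, ~ S z -> r <= enorm (x - z)).
Proof.
move=> [x0 Sx0] r0; rewrite /signed_dist.
set a := ereal_inf _; set b := ereal_inf _ => ab.
have a0 : (0 <= a)%E.
  by apply: le_ereal_inf_tmp => _ [y _ <-]; rewrite lee_fin enorm_ge0.
have ax0 : (a <= (enorm (x - x0))%:E)%E.
  by apply: ge_ereal_inf; exists (enorm (x - x0))%:E => //; exists x0.
have b0 : (0 <= b)%E.
  by apply: le_ereal_inf_tmp => _ [y _ <-]; rewrite lee_fin enorm_ge0.
have bz z : ~ S z -> (b <= (enorm (x - z))%:E)%E.
  by move=> Sz; apply: ge_ereal_inf; exists (enorm (x - z))%:E => //; exists z.
(* A point of [S] makes [a] finite, so it can be moved across the extended-real inequality. *)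
have aE : a = (fine a)%:E.
  by rewrite fineK // ge0_fin_numE // (le_lt_trans ax0) // ltry.
(* The point [z] also bounds [b] above, which excludes the value [+oo] taken when the complement is
   empty. *)
have abr z : ~ S z -> fine a + r <= enorm (x - z).
  move=> /bz; move: ab b0; rewrite aE; case: b bz => [b| |] _ //=.
  by rewrite !lee_fin; lra.
have fa0 : 0 <= fine a by rewrite fine_ge0.
split=> [e e0|z /abr]; last lra.
have enormxx : enorm (x - x) = 0.
  by rewrite subrr /enorm big1 ?sqrtr0 // => i _; rewrite !mxE expr0n.
have [Sx|Sx] := pselect (S x); first by exists x; rewrite // enormxx.
(* For [x] outside [S], the choice [z = x] in [abr] gives [fine a + r <= 0], so [a] is zero. *)
have : (a < e%:E)%E.
  by rewrite aE lte_fin; have := abr x Sx; rewrite enormxx; lra.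
by move=> /ereal_inf_lt[_ [y Sy <-]]; rewrite lte_fin => ye; exists y.
Qed.

(** * The sampling grid *)

Section sampling.
Context (R : realType) (T : R) (N : nat).
Hypotheses (T0 : 0 < T) (N0 : (0 < N)%N).

Let step_gt0 : 0 < T / N%:R. Proof. by rewrite divr_gt0 // ltr0n. Qed.

Lemma sample_time_step (i : nat) :
  sample_time T N i.+1 = sample_time T N i + T / N%:R.
Proof. by rewrite /sample_time -natr1 mulrDl mul1r. Qed.

Lemma sample_time_last : sample_time T N N = T.
Proof. by rewrite /sample_time mulrC divfK // pnatr_eq0 -lt0n. Qed.

Lemma sample_time_ge0 (i : nat) : 0 <= sample_time T N i.
Proof. by rewrite mulr_ge0 // ltW. Qed.

Lemma ltr_sample_time (i j : nat) :
  (sample_time T N i < sample_time T N j) = (i < j)%N.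
Proof. by rewrite ltr_pM2r // ltr_nat. Qed.

Lemma ler_sample_time (i j : nat) :
  (sample_time T N i <= sample_time T N j) = (i <= j)%N.
Proof. by rewrite ler_pM2r // ler_nat. Qed.

Lemma sample_time_gap (i j : nat) (t : R) :
  sample_time T N i < t < sample_time T N i.+1 -> t <> sample_time T N j.
Proof.
move=> + tj; rewrite tj !ltr_sample_time => /andP[ij ji].
by rewrite ltnS leqNgt ij in ji.
Qed.

Lemma sample_interval (t : R) : 0 <= t ->
  exists i, sample_time T N i <= t < sample_time T N i.+1.
Proof.
move=> t0; exists (Num.truncn (t / (T / N%:R))).
have /andP[] := truncn_itv (divr_ge0 t0 (ltW step_gt0)).
by rewrite ler_pdivlMr // ltr_pdivrMr // => -> ->.
Qed.

(** The index [N] must be allowed: [t = T] falls in the interval that starts at the last sample. *)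
Lemma sample_interval_ord (t : R) : 0 <= t <= T ->
  exists i : 'I_N.+1, sample_time T N i <= t < sample_time T N i.+1.
Proof.
move=> /andP[/sample_interval[i /andP[it ti]] tT].
have iN : (i < N.+1)%N.
  by rewrite ltnS -ler_sample_time sample_time_last (le_trans it).
by exists (Ordinal iN); rewrite it.
Qed.

End sampling.

(** * Solutions under the zero-order hold *)

Section solutions.
Context (R : realType) (n m : nat) (A : 'M[R]_n) (B : 'M[R]_(n, m)).
Context (Sigma : 'M[R]_n) (K : 'M[R]_(m, n)) (T : R) (N : nat).
Context (k : 'I_N.+1 -> 'cV[R]_m).
Hypotheses (T0 : 0 < T) (N0 : (0 < N)%N).

(** An open sampling interval contains no sampling time, so the two-sided derivative is available
    throughout it. *)
Lemma solution_within_sample (X : R -> 'cV[R]_(n + n * n)) (i : nat) :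
  (i < N)%N -> solves_aug_ode A B Sigma K T k X ->
  {within `[sample_time T N i, sample_time T N i.+1], continuous X} /\
  (forall t, t \in `]sample_time T N i, sample_time T N i.+1[ ->
     0 < t < T /\
     is_derive t 1 X (aug_A A B K *m X t + aug_B B *m aug_input Sigma T k t)).
Proof.
move=> iN [XC _ XD].
have iT : sample_time T N i.+1 <= T.
  by rewrite -[leRHS](sample_time_last T N0) ler_sample_time.
split=> [|t].
  apply: continuous_subspaceW XC => t /=; rewrite !in_itv /= => /andP[it ti].
  by rewrite (le_trans (sample_time_ge0 T0 N0 i) it) (le_trans ti).
rewrite in_itv /= => /andP[it ti].
have tT : 0 < t < T.
  by rewrite (le_lt_trans (sample_time_ge0 T0 N0 i) it) (lt_le_trans ti).
split=> //; apply: XD => // j.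
by apply: (@sample_time_gap _ _ _ T0 N0 i); rewrite it ti.
Qed.

(** Induction over sampling intervals: the common input cancels in the difference, and agreement on
    a closed interval supplies the initial value for the next one. *)
Lemma solution_unique (X Y : R -> 'cV[R]_(n + n * n)) :
  X 0 = Y 0 -> solves_aug_ode A B Sigma K T k X ->
  solves_aug_ode A B Sigma K T k Y ->
  forall t, 0 <= t <= T -> X t = Y t.
Proof.
move=> XY0 XS YS.
have step i : (i < N)%N -> X (sample_time T N i) = Y (sample_time T N i) ->
    forall t, sample_time T N i <= t <= sample_time T N i.+1 -> X t = Y t.
  move=> iN XYi t it.
  have [XC XD] := solution_within_sample iN XS.
  have [YC YD] := solution_within_sample iN YS.
  apply/eqP; rewrite -subr_eq0; apply/eqP; rewrite -[LHS]/((X - Y) t).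
  apply: (linear_ode_eq0 (E := aug_A A B K) _ _ _ it).
  - move=> s si; have [_ XDs] := XD s si; have [_ YDs] := YD s si.
    have XYD := is_deriveB XDs YDs; apply: is_derive_eq XYD _.
    by rewrite [(X - Y) s]/(X s - Y s) mulmxBr opprD addrACA subrr addr0.
  - by move=> s; apply: cvgB; [exact: XC | exact: YC].
  - by rewrite -[LHS]/(X _ - Y _) XYi subrr.
have samples i : (i <= N)%N -> X (sample_time T N i) = Y (sample_time T N i).
  elim: i => [_|i IH iN]; first by rewrite /sample_time mul0r.
  by apply: (step i iN (IH (ltnW iN))); rewrite lexx ler_sample_time // leqnSn.
move=> t tT; have [[i iN] /= /andP[it ti]] := sample_interval_ord T0 N0 tT.
(* For index [N] the interval meets [[0, T]] only at [T], already covered by [samples]. *)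
move: iN; rewrite ltnS leq_eqVlt => /predU1P[iN|iN].
  have -> : t = sample_time T N i; last by apply: samples; rewrite iN.
  apply/eqP; rewrite eq_le it andbT iN sample_time_last //.
  by case/andP: tT.
by apply: (step i iN (samples i (ltnW iN))); rewrite it ltW.
Qed.

End solutions.

(** * Admissibility and containment between sampling times *)

Theorem theorem1 (R : realType) (n m : nat)
    (A : 'M[R]_n) (B : 'M[R]_(n, m)) (hAB : stabilizable A B)
    (Sigma : 'M[R]_n) (hSigma_diag : is_diag_mx Sigma) (hSigma_psd : psd Sigma)
    (XX : set 'cV[R]_(n + n * n)) (hXX : closed XX)
    (UU : set 'cV[R]_(m + n * n)) (hUU : closed UU)
    (S1 S2 : set 'cV[R]_(n + n * n))
    (hS1 : polytope S1) (hS2 : polytope S2)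
    (hS12 : ~ separated S1 S2 \/ S1 `&` S2 !=set0)
    (T : R) (hT : 0 < T) (N : nat) (hN : (1 <= N)%N)
    (Q : 'M[R]_m) (hQ : psd Q)
    (K : 'M[R]_(m, n)) (D : 'cV[R]_(n * n)) (M : R)
    (X0 : 'cV[R]_(n + n * n)) (hX0 : S1 X0)
    (k : 'I_N.+1 -> 'cV[R]_m)
    (hk : optimal A B Sigma UU S1 S2 T Q K M X0 k)
    (X : R -> 'cV[R]_(n + n * n))
    (hX_init : X 0 = X0) (hX_ode : solves_aug_ode A B Sigma K T k X)
    (hK : hurwitz (A + B *m K))
    (hM : forall (x : 'cV[R]_(n + n * n)) (u : 'cV[R]_(m + n * n)),
        XX x -> UU u -> enorm (aug_A A B K *m x + aug_B B *m u) <= M)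
    (hXX_traj : forall t : R, 0 <= t <= T -> XX (X t))
    (hD : forall t : R, 0 <= t <= T ->
        cvle 0 (dsubmx (X t)) /\ cvle (dsubmx (X t)) D) :
  [/\ solves_aug_ode A B Sigma K T k X,
      forall t : R, 0 <= t <= T -> UU (aug_input Sigma T k t),
      forall t : R, 0 <= t < T -> S1 (X t)
    & S2 (X T)].
Proof.
have N0 : (0 < N)%N by [].
have [[Y [Y0 Y_ode UUk Y_dist YT]] _] := hk.
(* The distance and terminal constraints concern [Y], the speed bound concerns [X]; uniqueness
   combines them. *)
have XY := solution_unique hT N0 (etrans hX_init (esym Y0)) hX_ode Y_ode.
(* The held input at [t] equals its value at the preceding sample, where the constraint is
   imposed. *)
have UUt t : 0 <= t <= T -> UU (aug_input Sigma T k t).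
  move=> /(sample_interval_ord hT N0)[i ti].
  have := UUk i; rewrite /aug_input (zohE k hT N0 ti) (@zohE _ _ _ _ k i) //.
  by rewrite lexx ltr_sample_time // leqnn.
have sample_in (i : 'I_N.+1) : 0 <= sample_time T N i <= T.
  rewrite sample_time_ge0 //= -[leRHS](sample_time_last T N0).
  by rewrite ler_sample_time // -ltnS.
split=> //; last by rewrite XY // lexx ltW.
move=> t /andP[t0 tT].
have tT' : 0 <= t <= T by rewrite t0 ltW.
have [i /andP[it ti]] := sample_interval_ord hT N0 tT'.
(* Since [t < T], the index [N] is excluded and the interval lies within [[0, T]]. *)
have iN : (i < N)%N.
  by rewrite -(ltr_sample_time hT N0) sample_time_last // (le_lt_trans it).
set s := sample_time T N i in it.
(* [M] bounds a norm at the admissible pair formed by state and input at time [t]. *)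
have M0 : 0 <= M.
  apply: le_trans (enorm_ge0 _) (hM _ _ (hXX_traj t tT') (UUt t tT')).
have step0 : 0 < T / N%:R by rewrite divr_gt0 // ltr0n.
have := Y_dist i; rewrite -/s -XY ?sample_in // => dist_i.
have [near_S1 far_compl] := signed_dist_le (ex_intro _ X0 hX0)
  (mulr_ge0 M0 (ltW step0)) dist_i.
have S1s := polytope_enorm_closed hS1 near_S1.
have [XC XD] := solution_within_sample hT N0 iN hX_ode.
have Xts : enorm (X t - X s) <= M * (t - s).
  have sub u : u \in `]s, t[ -> u \in `]s, sample_time T N i.+1[.
    by rewrite !in_itv /= => /andP[-> /lt_trans]; apply.
  pose dX u := aug_A A B K *m X u + aug_B B *m aug_input Sigma T k u.
  apply: (mean_value_enorm (dX := dX)) => //.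
  - by move=> u /sub /XD[].
  - move=> u /sub /XD[/andP[u0 uT] _].
    by apply: hM; [apply: hXX_traj | apply: UUt]; rewrite ?(ltW u0) ?(ltW uT).
  - apply: continuous_subspaceW XC => u /=; rewrite !in_itv /= => /andP[-> /=].
    by move=> /le_trans; apply; rewrite ltW.
have [//|/far_compl] := pselect (S1 (X t)).
rewrite enormB => far_t.
(* [M * (T / N) <= |X t - X s| <= M * (t - s)] and [t - s < T / N] force
   [M = 0], so the trajectory is at rest. *)
have tsd : t - s < T / N%:R by rewrite ltrBlDl -sample_time_step.
have ts0 : enorm (X t - X s) <= 0 by nra.
by move/enorm_le0_eq0/eqP: ts0; rewrite subr_eq0 => /eqP ->.
Qed.
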